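(* Let $w$ be a timed tableau in $A_n$ and let $v$ be a timed row in $A_n$. Then $\mathrm{INSERT}(w,v)$ is again a timed tableau in $A_n$, one has $\mathrm{wt}(\mathrm{INSERT}(w,v))=\mathrm{wt}(w)+\mathrm{wt}(v)$, and $\mathrm{shape}(w)$ interleaves $\mathrm{shape}(\mathrm{INSERT}(w,v))$.
   Context: Let $A_n=\{1,\dots,n\}$ with its usual order. A timed word of length $r\ge 0$ in $A_n$ is a right-continuous piecewise-constant function $w:[0,r)\to A_n$ with finitely many discontinuities; write $l(w)=r$. We write $w=c_1^{t_1}\cdots c_k^{t_k}$ ($t_i>0$) if $w$ takes the value $c_i$ on $[t_1+\dots+t_{i-1},t_1+\dots+t_i)$; adjacent equal letters may be merged ($c^{s}c^{t}=c^{s+t}$). Timed words are multiplied by concatenation; $\emptyset$ is the empty word. The weight of $w$ is $\mathrm{wt}(w)=(m_1,\dots,m_n)$ where $m_i$ is the Lebesgue measure of $w^{-1}(i)$. For $0\le a<b\le l(w)$, $w_{[a,b)}$ is the timed word of length $b-a$ with $w_{[a,b)}(t)=w(a+t)$. A timed row is a weakly increasing timed word, i.e. one of the form $1^{t_1}2^{t_2}\cdots n^{t_n}$ with $t_i\ge 0$. Every timed word has a unique row decomposition $w=u_l u_{l-1}\cdots u_1$ with each $u_i$ a timed row and $u_iu_{i-1}$ not a timed row for $i=2,\dots,l$. For timed rows $u,v$ write $u\lhd v$ if $l(u)\ge l(v)$ and $u(t)<v(t)$ for all $0\le t<l(v)$. A real partition is a weakly decreasing finite sequence of non-negative reals, two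 being equal if they differ by trailing zeros. A timed tableau is a timed word whose row decomposition $u_l\cdots u_1$ satisfies $u_1\lhd u_2\lhd\cdots\lhd u_l$; its shape is $(l(u_1),\dots,l(u_l))$. Given real partitions $\lambda=(\lambda_1,\dots,\lambda_l)$ and $\mu=(\mu_1,\dots,\mu_{l-1})$ (padding with zeros as needed), $\mu$ interleaves $\lambda$ if $\lambda_1\ge\mu_1\ge\lambda_2\ge\mu_2\ge\dots\ge\mu_{l-1}\ge\lambda_l$. Timed row insertion: for a timed row $u$, a letter $c$ and $t_c\ge0$: if $u(t)\le c$ for all $t$, then $\mathrm{RINS}(u,c^{t_c})=(\emptyset,uc^{t_c})$; otherwise let $t_0=\min\{t: u(t)>c\}$ and set $\mathrm{RINS}(u,c^{t_c})=(u_{[t_0,t_0+t_c)},\,u_{[0,t_0)}c^{t_c}u_{[t_0+t_c,l(u))})$ if $l(u)-t_0>t_c$, and $=(u_{[t_0,l(u))},\,u_{[0,t_0)}c^{t_c})$ if $l(u)-t_0\le t_c$. For a timed row $v=c_1^{t_1}\cdots c_k^{t_k}$, inductively: if $(v',u')=\mathrm{RINS}(u,c_1^{t_1}\cdots c_{k-1}^{t_{k-1}})$ and $(v'',u'')=\mathrm{RINS}(u',c_k^{t_k})$, then $\mathrm{RINS}(u,v)=(v'v'',u'')$ (this is well defined). Timed tableau insertion: if $w$ is a timed tableau with row decomposition $u_l\cdots u_1$ and $v$ a timed row, put $v_0'=v$, $(v_i',u_i')=\mathrm{RINS}(u_i,v_{i-1}')$ for $i=1,\dots,l$, and $\mathrm{INSERT}(w,v)=v_l'u_l'\cdots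 u_1'$. *)

(* Defs.v *)
From HB Require Import structures.
From mathcomp Require Import all_boot all_order all_algebra.
From mathcomp Require Import all_classical all_reals all_analysis.
Import Order.TTheory GRing.Theory Num.Theory.
Import numFieldNormedType.Exports.

Set Implicit Arguments.
Unset Strict Implicit.
Unset Printing Implicit Defensive.

Local Open Scope classical_set_scope.
Local Open Scope ring_scope.

(* A word of length r is a total function on R that is None exactly outside   *)
(* [0, r) (see [is_timed_word]), so that two timed words are the same iff     *)
(* they are Leibniz equal.  The letter i+1 of A_n is encoded as i : 'I_n.     *)
Record preword (R : realType) (n : nat) :=
  Preword { tlen : R ; tval : R -> option 'I_n }.

HB.instance Definition _ (R : realType) (n : nat) :=
  gen_eqMixin (preword R n).
HB.instance Definition _ (R : realType) (n : nat) :=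
  gen_choiceMixin (preword R n).

Section TimedWords.
Variables (R : realType) (n : nat).
Local Notation word := (preword R n).
Implicit Types (u v w : word) (c : 'I_n) (us : seq word).

(* Continuity refers to the discrete topology on A_n; with finitely many      *)
(* discontinuities it makes w piecewise constant.  At 0, continuity on [0, r) *)
(* is right-continuity.                                                       *)
Definition is_timed_word w : Prop :=
  [/\ 0 <= tlen w,
      forall t, (tval w t != None) = (0 <= t < tlen w),
      forall t, 0 <= t < tlen w -> \forall s \near t^'+, tval w s = tval w t
    & finite_set [set t | 0 < t < tlen w /\
                          ~ (\forall s \near t, tval w s = tval w t)]].

Definition tempty : word := Preword 0 (fun=> None).

Definition tpow c (t : R) : word :=
  Preword t (fun x => if 0 <= x < t then Some c else None).

Definition tcat u v : word :=
  Preword (tlen u + tlen v)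
    (fun x => if x < tlen u then tval u x else tval v (x - tlen u)).

Definition tsub w (a b : R) : word :=
  Preword (b - a) (fun t => if 0 <= t < b - a then tval w (a + t) else None).

Definition twt w : 'rV[R]_n :=
  \row_(i < n) fine (lebesgue_measure [set t : R | tval w t = Some i]).

Definition is_timed_row u : Prop :=
  is_timed_word u /\
  forall s t i j, s <= t -> tval u s = Some i -> tval u t = Some j ->
    (i <= j)%N.

(* Rows are listed as us = [:: u_1; ...; u_l] while the word is u_l ... u_1. *)
Definition rows_word us : word := foldr tcat tempty (rev us).

(* Rows are required to be nonempty; for l >= 2 this is automatic, and it     *)
(* makes the decomposition of the empty word unique (l = 0).                  *)
Definition row_decomposition w us : Prop :=
  [/\ w = rows_word us,
      forall u, u \in us -> is_timed_row u /\ 0 < tlen u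
    & forall k, (k.+1 < size us)%N ->
        ~ is_timed_row (tcat (nth tempty us k.+1) (nth tempty us k))].

Definition row_dec w : seq word := xget [::] [set us | row_decomposition w us].

Definition row_lhd u v : Prop :=
  tlen v <= tlen u /\
  forall t, 0 <= t < tlen v ->
    exists i j, [/\ tval u t = Some i, tval v t = Some j & (i < j)%N].

Definition is_timed_tableau w : Prop :=
  is_timed_word w /\
  exists2 us, row_decomposition w us &
    forall k, (k.+1 < size us)%N ->
      row_lhd (nth tempty us k) (nth tempty us k.+1).

Definition tshape w : seq R := [seq tlen u | u <- row_dec w].

Definition real_partition (s : seq R) : Prop :=
  sorted >=%R s /\ all (fun x => 0 <= x) s.

(* Padding by zeros is [nth 0]; beyond the ends of both sequences the         *)
(* inequalities read 0 >= 0.                                                  *)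
Definition interleaves (mu lam : seq R) : Prop :=
  [/\ real_partition mu, real_partition lam
    & forall k, lam`_k.+1 <= mu`_k <= lam`_k].

(* On a timed row the set below, when nonempty, has a minimum, by             *)
(* right-continuity.                                                          *)
Definition first_above u c : R :=
  inf [set t | exists2 j, tval u t = Some j & (c < j)%N].

Definition rins1 u c (tc : R) : word * word :=
  if `[< forall t j, tval u t = Some j -> (j <= c)%N >]
  then (tempty, tcat u (tpow c tc))
  else
    let t0 := first_above u c in
    if tc < tlen u - t0
    then (tsub u t0 (t0 + tc),
          tcat (tcat (tsub u 0 t0) (tpow c tc)) (tsub u (t0 + tc) (tlen u)))
    else (tsub u t0 (tlen u), tcat (tsub u 0 t0) (tpow c tc)).

Definition runs_word (cs : seq ('I_n * R)) : word :=
  foldr (fun ct w => tcat (tpow ct.1 ct.2) w) tempty cs.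

Definition runs_decomposition w (cs : seq ('I_n * R)) : Prop :=
  w = runs_word cs /\ all (fun ct => 0 < ct.2) cs.

(* An arbitrary expression c_1^{t_1} ... c_k^{t_k} of w: adjacent letters may *)
(* be equal.  The result of row insertion does not depend on this choice.     *)
Definition runs w : seq ('I_n * R) :=
  xget [::] [set cs | runs_decomposition w cs].

Definition rins_runs u (cs : seq ('I_n * R)) : word * word :=
  foldl (fun p ct => let q := rins1 p.2 ct.1 ct.2 in (tcat p.1 q.1, q.2))
    (tempty, u) cs.

Definition rins u v : word * word := rins_runs u (runs v).

Fixpoint insert_rows us v : word :=
  if us is u :: us' then
    let p := rins u v in tcat (insert_rows us' p.1) p.2
  else v.

Definition tinsert w v : word := insert_rows (row_dec w) v.

End TimedWords.

Arguments tempty {R n}.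

(* Main.v *)
Require Import Defs.
From mathcomp Require Import all_boot all_order all_algebra.
From mathcomp Require Import all_classical all_reals all_analysis.
From mathcomp Require Import lra zify.
Import Order.TTheory GRing.Theory Num.Theory.
Local Open Scope ring_scope.

(* Encode a timed row u by its cumulative function U, where U k is the length *)
(* of the part of u with letters < k; thus u(t) = i iff U i <= t < U (i+1).   *)
(* Inserting the row with cumulative function V gives the last-passage        *)
(* recursion B (k+1) = max (B k) (U (k+1)) + V (k+1) - V k, and the ejected   *)
(* row has cumulative function D = U + V - B.  The relation u <| w becomes    *)
(* W (k+1) <= U k for all k.  Since                                           *)
(* D (k+1) - D k = min (B k) (U (k+1)) - U k, inserting D into the next row W *)
(* gives a row B' with                                                        *)
(* B' (k+1) <= min (B k) (U (k+1)), by induction on k: the first bound is the *)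
(* tableau condition for the new rows, the second is half of interleaving.    *)

Set Implicit Arguments.
Unset Strict Implicit.

(* [tval] of Defs is shadowed by the projection of tuples. *)
Local Notation tval := Defs.tval.

(** In cumulative coordinates the theorem is about real sequences. A row is determined by its
    cumulative function ([row_cumul], [cumul_inj]), [rins_cumul] turns row insertion into the
    recursion [bump], and [row_lhdP] turns the tableau condition into inequalities between
    consecutive rows.

    The core is [bump_ejected], which [insert_rows_spec] carries through all rows. Interleaving is
    the case k = n of B' k <= U k <= B k, whose right half is [bump_ge]. Each row insertion
    satisfies B + D = U + V, so the sum of the cumulative functions over all rows grows by exactly
    V; by [weight_rows] its increments are the weight.

    The rows so computed are the ones [row_dec] selects, because a row decomposition is unique: its
    last factor is the longest suffix that is a row ([last_row_maximal]). *)

Ltac minmax_free x :=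
  lazymatch x with
  | context [Order.max _ _] => fail
  | context [Order.min _ _] => fail
  | _ => idtac
  end.

Ltac minmax_lra :=
  repeat match goal with
  | |- context [Order.max ?a ?b] =>
      minmax_free a; minmax_free b; case: (leP a b) => ?
  | |- context [Order.min ?a ?b] =>
      minmax_free a; minmax_free b; case: (leP a b) => ?
  end; lra.

(** * Algebra of concatenation, using only the domains of words *)

Section Prewords.
Variables (R : realType) (n : nat).
Implicit Types (u v w : preword R n) (c i j : 'I_n).

Lemma preword_ext u v :
  tlen u = tlen v -> (forall t i, tval u t = Some i <-> tval v t = Some i) ->
  u = v.
Proof.
case: u v => [lu fu] [lv fv] /= -> uv; congr Preword; apply/funext => t.
case E: (fu t) => [i|]; first by symmetry; apply/uv.
by case E': (fv t) => [i|] //; move/uv: E'; rewrite E.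
Qed.

Definition wfword w :=
  0 <= tlen w /\ forall t, (tval w t != None) = (0 <= t < tlen w).

Lemma timed_word_wf w : is_timed_word w -> wfword w.
Proof. by case. Qed.

Lemma wfword_dom w t i : wfword w -> tval w t = Some i -> 0 <= t < tlen w.
Proof. by case=> _ <- ->. Qed.

Lemma wfword_Some w t : wfword w -> 0 <= t < tlen w ->
  exists i, tval w t = Some i.
Proof. by case=> _ <-; case: (tval w t) => // i _; exists i. Qed.

Lemma wfword_None w t : wfword w -> ~~ (0 <= t < tlen w) -> tval w t = None.
Proof. by move=> [_ <-]; case: (tval w t). Qed.

Lemma wfword_tempty : wfword tempty.
Proof. by split => //= t; apply/esym/negbTE/negP; lra. Qed.

Lemma wfword_tpow c (t : R) : 0 <= t -> wfword (tpow c t).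
Proof. by move=> t0; split => //= x; case: ifP. Qed.

Lemma wfword_tcat u v : wfword u -> wfword v -> wfword (tcat u v).
Proof.
move=> [u0 uE] [v0 vE]; split => [|t] /=; first exact: addr_ge0.
by case: ltP => tu; rewrite ?uE ?vE; apply/idP/idP; lra.
Qed.

Lemma tcatA u v w : 0 <= tlen v ->
  tcat u (tcat v w) = tcat (tcat u v) w.
Proof.
move=> v0; rewrite /tcat /= addrA; congr Preword; apply/funext => t.
have [tu|tu] := ltP t (tlen u); first by rewrite ifT //; lra.
by rewrite ltrBlDl; case: ifP => //; rewrite opprD addrA.
Qed.

Lemma tcat0w w : wfword w -> tcat tempty w = w.
Proof.
move=> hw; case: (w) hw => [l f] hw; rewrite /tcat /= add0r; congr Preword.
apply/funext => t; rewrite subr0; case: ltP => // t0.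
by rewrite -[f]/(tval (Preword l f)) wfword_None //= leNgt t0.
Qed.

Lemma tcatw0 w : wfword w -> tcat w tempty = w.
Proof.
move=> hw; case: (w) hw => [l f] hw; rewrite /tcat /= addr0; congr Preword.
apply/funext => t; case: ltP => // t0.
by rewrite -[f]/(tval (Preword l f)) wfword_None //= ltNge t0 andbF.
Qed.

Lemma wfword_foldr_tcat (rs : seq (preword R n)) :
  (forall u, u \in rs -> wfword u) -> wfword (foldr (@tcat R n) tempty rs).
Proof.
elim: rs => [_|u rs IH rsP] /=; first exact: wfword_tempty.
apply: wfword_tcat; first by apply: rsP; rewrite mem_head.
by apply: IH => v vrs; apply: rsP; rewrite inE vrs orbT.
Qed.

Lemma foldr_tcat_cat (rs rs' : seq (preword R n)) :
  (forall u, u \in rs ++ rs' -> wfword u) ->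
  foldr (@tcat R n) tempty (rs ++ rs') =
  tcat (foldr (@tcat R n) tempty rs) (foldr (@tcat R n) tempty rs').
Proof.
elim: rs => [|u rs IH] rsP /=.
  by rewrite tcat0w //; apply: wfword_foldr_tcat.
have rsP' v : v \in rs ++ rs' -> wfword v.
  by move=> vrs; apply: rsP; rewrite inE vrs orbT.
rewrite IH // tcatA //; suff [] : wfword (foldr (@tcat R n) tempty rs) by [].
by apply: wfword_foldr_tcat => v vrs; apply: rsP'; rewrite mem_cat vrs.
Qed.

Lemma rows_word_cons u us :
  (forall v, v \in u :: us -> wfword v) ->
  rows_word (u :: us) = tcat (rows_word us) u.
Proof.
move=> uP; have wu : wfword u by apply: uP; rewrite mem_head.
rewrite /rows_word rev_cons -cats1 foldr_tcat_cat /= ?tcatw0 // => v.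
by rewrite mem_cat mem_rev inE orbC -in_cons => /uP.
Qed.

End Prewords.

(** * Closure of timed words under concatenation *)

Section TimedWordConcat.
Variables (R : realType) (n : nat).
Implicit Types (u v w : preword R n).
Local Open Scope classical_set_scope.

Lemma timed_word_tempty : is_timed_word (@tempty R n).
Proof.
have [h1 h2] := @wfword_tempty R n.
split => // [t /=|]; first by move=> ?; lra.
apply: (sub_finite_set _ (finite_set0 _)) => t /= [t0 _]; lra.
Qed.

Lemma timed_word_tcat u v :
  is_timed_word u -> is_timed_word v -> is_timed_word (tcat u v).
Proof.
move=> hu hv.
have [uv0 uvE] := wfword_tcat (timed_word_wf hu) (timed_word_wf hv).
case: hu hv => u0 _ ru fu [v0 _ rv fv]; split => // [t|].
  move=> tuv /=; have [tu|tu] := ltP t (tlen u).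
    have h : 0 <= t < tlen u by lra.
    near=> s; rewrite ifT; last by near: s; exact: nbhs_right_lt.
    by near: s; exact: ru.
  have h : 0 <= t - tlen u < tlen v by move: tuv => /=; lra.
  have := rv _ h; rewrite -{1}[t - tlen u]/(t + - tlen u) => hs.
  have {}hs : \forall s \near t^'+, tval v (s - tlen u) = tval v (t - tlen u).
    move: hs => [e /= e0 he]; exists e => // s /= ts lts; apply: he => /=.
      move: ts; rewrite /ball_ /= => ts.
      by have -> : t - tlen u - (s - tlen u) = t - s by lra.
    by lra.
  near=> s; rewrite ifF; first by near: s.
  apply/negbTE; rewrite -leNgt; apply: le_trans tu _; apply: ltW.
  by near: s; exact: nbhs_right_gt.
pose Dv := [set t | 0 < t < tlen v /\
  ~ (\forall s \near t, tval v s = tval v t)].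
(* A discontinuity of the product is one of [u], the junction, or a shifted one of [v]. *)
apply: (@sub_finite_set _ _ ([set t | 0 < t < tlen u /\
   ~ (\forall s \near t, tval u s = tval u t)] `|` [set tlen u]
   `|` (fun t => t + tlen u) @` Dv)); last first.
  by rewrite !finite_setU; split; [split => //; exact: finite_set1|
    exact: finite_image].
move=> t /= [/= tuv tn].
have [tu|tu|->] := ltgtP t (tlen u); last by left; right.
  left; left; split; first by lra.
  move=> h; apply: tn; near=> s; rewrite !ifT //; last first.
    by near: s; exact: lt_nbhsl.
  by near: s.
right; exists (t - tlen u); last by lra.
split; first by lra.
move=> h; apply: tn; rewrite (ltNge t) (ltW tu) /=.
have {}h : \forall s \near t, tval v (s - tlen u) = tval v (t - tlen u).
  move: h => [e /= e0 he]; exists e => // s /= ts; apply: he => /=.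
  move: ts; rewrite /ball_ /= => ts.
  by have -> : t - tlen u - (s - tlen u) = t - s by lra.
near=> s; rewrite ifF; first by near: s.
by apply/negbTE; rewrite -leNgt; apply: ltW; near: s; exact: lt_nbhsr.
Unshelve. all: end_near. Qed.

End TimedWordConcat.

(** * Cumulative functions of timed rows *)

Section Cumulative.
Variables (R : realType) (n : nat).
Implicit Types (u v w : preword R n) (c i j : 'I_n) (U V : nat -> R) (k : nat).
Local Open Scope classical_set_scope.

(** [U] is defined on all naturals and constant from n on, so that rows can be compared without
    bounds on the index. Letters start at 0, so letter i occupies the interval from U i to U
    (i+1). *)
Definition cumul u U :=
  [/\ U 0%N = 0, {homo U : i j / (i <= j)%N >-> i <= j},
      forall k, (n <= k)%N -> U k = tlen u
    & forall t i, tval u t = Some i <-> U i <= t < U i.+1].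

Lemma cumul_ge0 u U k : cumul u U -> 0 <= U k.
Proof. by case=> U0 Um _ _; rewrite -U0 Um. Qed.

Lemma cumul_le u U k : cumul u U -> U k <= tlen u.
Proof.
by case=> _ Um Un _; rewrite -(Un (maxn k n)) ?Um ?leq_maxl ?leq_maxr.
Qed.

Lemma cumul_S u U k : cumul u U -> U k <= U k.+1.
Proof. by case=> _ Um _ _; apply: Um. Qed.

Lemma cumul_find u U t : cumul u U -> 0 <= t < tlen u ->
  exists i, U i <= t < U i.+1.
Proof.
move=> [U0 Um Un _] /andP[t0 tl].
have ex : exists k, t < U k by exists n; rewrite Un.
case: (ex_minnP ex) => -[|k] tk kmin; first by move: tk; rewrite U0; lra.
have kn : (k < n)%N.
  rewrite ltnNge; apply/negP => nk; have := kmin n.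
  by rewrite Un // tl => /(_ isT); lia.
exists (Ordinal kn) => /=; rewrite tk andbT leNgt; apply/negP => /kmin.
by rewrite ltnn.
Qed.

Lemma cumul_lt u U t i k : cumul u U -> tval u t = Some i ->
  (i < k)%N = (t < U k).
Proof.
move=> [_ Um _ uE] /uE /andP[it ti]; apply/idP/idP => [ik|tk].
  by apply: lt_le_trans ti _; apply: Um.
by rewrite ltnNge; apply/negP => /Um ki; lra.
Qed.

Lemma cumul_wf u U : cumul u U -> wfword u.
Proof.
move=> hU; split; first exact: (le_trans (cumul_ge0 0 hU) (cumul_le 0 hU)).
move=> t; apply/idP/idP.
  case E: (tval u t) => [i|] // _; have [_ _ _ uE] := hU.
  by move/uE : E; have := cumul_ge0 i hU; have := cumul_le i.+1 hU; lra.
by move=> /(cumul_find hU)[i]; case: hU => _ _ _ uE /uE ->.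
Qed.

(** If U k < V k, the letter at position U k would be at least k according to U and below k
    according to V. *)
Lemma cumul_unique u U V : cumul u U -> cumul u V -> U = V.
Proof.
suff le : forall U V k, cumul u U -> cumul u V -> V k <= U k.
  by move=> hU hV; apply/funext => k; apply/eqP; rewrite eq_le !le.
move=> {}U {}V k hU hV; rewrite leNgt; apply/negP => UV.
have [|i Ui] := @cumul_find u U (U k) hU.
  by rewrite (cumul_ge0 k hU) /=; have := cumul_le k hV; lra.
have uE : tval u (U k) = Some i by case: hU => _ _ _ /(_ (U k) i) [_ ->].
have := cumul_lt k hV uE; rewrite UV => ik.
by have := cumul_lt k hU uE; rewrite ik ltxx.
Qed.

Lemma cumul_row u U : cumul u U -> is_timed_row u.
Proof.
move=> hU; have [u0 uD] := cumul_wf hU; have [U0 Um Un uE] := hU.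
split; last first.
  move=> s t i j st us ut; rewrite -ltnS.
  rewrite (cumul_lt _ hU us); have := cumul_lt j.+1 hU ut; rewrite ltnS leqnn.
  by lra.
split => // [t tu|].
  have [i iP] := cumul_find hU tu.
  rewrite (_ : tval u t = Some i); last exact/uE.
  have /andP[it ti] := iP.
  near=> s; apply/uE; apply/andP; split.
    by apply: (@le_trans _ _ t); [exact: it|near: s; exact: nbhs_right_ge].
  by near: s; exact: nbhs_right_lt.
apply: (@sub_finite_set _ _ ((U \o @nat_of_ord n) @` setT)); last first.
  exact: finite_image.
move=> t /= [tu tn]; have [|i /andP[it ti]] := @cumul_find u U t hU; first lra.
exists i => //=; apply/eqP; rewrite eq_le it /= leNgt; apply/negP => {}it.
apply: tn; rewrite (_ : tval u t = Some i); last by apply/uE; lra.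
near=> s; apply/uE; apply/andP; split.
  by apply: ltW; near: s; exact: lt_nbhsr.
by near: s; exact: lt_nbhsl.
Unshelve. all: end_near. Qed.

(* The length of the part of [u] whose letters are below [k]. *)
Definition cumfn u k : R := inf [set t | 0 <= t /\
  (tlen u <= t \/ exists2 j, tval u t = Some j & (k <= j)%N)].

(** The set [S k] is closed upwards because the row is increasing, and contains its infimum because
    the row is right-continuous. Hence it is the closed half-line starting at [cumfn u k], and the
    four clauses follow. *)
Lemma row_cumul u : is_timed_row u -> cumul u (cumfn u).
Proof.
move=> [hu um]; have wu := timed_word_wf hu.
have [u0 uD ur _] := hu.
set S := fun k => [set t | 0 <= t /\
  (tlen u <= t \/ exists2 j, tval u t = Some j & (k <= j)%N)].
have Sup k s t : S k s -> s <= t -> S k t.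
  move=> [s0 sP] st; split; first lra.
  have [tu|ut] := leP (tlen u) t; [by left|right].
  case: sP => [|[j us kj]]; first lra.
  have [|i ui] := wfword_Some (t := t) wu; first lra.
  by exists i => //; apply: leq_trans kj _; apply: um us ui.
have Slb k : has_lbound (S k) by exists 0 => t [].
have Su k : S k (tlen u) by split => //; left.
have SE k t : S k t <-> cumfn u k <= t.
  split=> [St|]; first exact: (ge_inf (Slb k)).
  move=> kt; apply: (Sup _ (cumfn u k)) => //; apply: contrapT => Sn.
  have c0 : 0 <= cumfn u k.
    by apply: (@lb_le_inf _ (S k)); [exists (tlen u)|move=> ? []].
  have cl : cumfn u k < tlen u.
    by rewrite ltNge; apply/negP => uc; apply: Sn; split => //; left.
  have [|j uj] := wfword_Some (t := cumfn u k) wu; first lra.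
  have jk : (j < k)%N.
    rewrite ltnNge; apply/negP => kj.
    by apply: Sn; split => //; right; exists j.
  have h : 0 <= cumfn u k < tlen u by lra.
  (* Were the infimum outside [S k], its letter j < k would persist a little to the right, up to
     some s that is then a lower bound of [S k]. *)
  near (cumfn u k)^'+ => s.
  have us : tval u s = Some j by rewrite -uj; near: s; exact: ur.
  have sl : s < tlen u by near: s; exact: nbhs_right_lt.
  have cs : cumfn u k < s by near: s; exact: nbhs_right_gt.
  suff : s <= cumfn u k by lra.
  apply: (@lb_le_inf _ (S k)); first by exists (tlen u).
  move=> t' St'; rewrite leNgt; apply/negP => t's.
  have [s0 [|[j' us']]] := Sup _ _ _ St' (ltW t's); first lra.
  by move: us'; rewrite us => -[<-]; lia.
split.
- apply/eqP; rewrite eq_le; apply/andP; split; last first.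
    by have /SE[] := lexx (cumfn u 0).
  apply/SE; split => //; have [|ul] := leP (tlen u) 0; [by left|right].
  have [|j uj] := wfword_Some (t := 0) wu; first lra.
  by exists j.
- move=> i j ij; apply/SE; have /SE[c0 cP] := lexx (cumfn u j).
  split => //; case: cP => [|[j' uj jj]]; [by left|right].
  by exists j' => //; exact: leq_trans jj.
- move=> k nk; apply/eqP; rewrite eq_le; apply/andP; split; first exact/SE.
  have /SE[_ [//|[j _ kj]]] := lexx (cumfn u k).
  by have := ltn_ord j; lia.
- move=> t i; split => [ut|].
    have := wfword_dom wu ut => tu.
    apply/andP; split; first by apply/SE; split; [lra|right; exists i].
    rewrite ltNge; apply/negP => /SE[_ [|[j]]]; first lra.
    by rewrite ut => -[<-]; rewrite ltnn.
  move=> /andP[/SE[t0 tP] ti].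
  case: tP => [tu|[j uj ij]].
    have /SE : S i.+1 t by split => //; left.
    by move=> it; exfalso; lra.
  rewrite uj; congr Some; apply/val_inj/eqP; rewrite /= eqn_leq ij andbT leqNgt.
  apply/negP => ji; have /SE : S i.+1 t by split => //; right; exists j.
  by move=> it; lra.
Unshelve. all: end_near. Qed.

Lemma cumfn_cumul u U : cumul u U -> cumfn u = U.
Proof.
by move=> hU; exact: cumul_unique (row_cumul (cumul_row hU)) hU.
Qed.

Lemma cumul_tempty : cumul tempty (fun=> 0 : R).
Proof. by split => // t i; split => // h; exfalso; lra. Qed.

Lemma cumul_inj u v U : cumul u U -> cumul v U -> u = v.
Proof.
move=> [_ _ un uE] [_ _ vn vE]; apply: preword_ext => [|t i].
  by rewrite -(un n) // -(vn n).
by rewrite uE vE.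
Qed.

(** The last hypothesis says that the product has no descent: for each threshold k, either all
    letters of [u] are below k or no letter of [v] is. *)
Lemma cumul_tcat u v U V : cumul u U -> cumul v V ->
  (forall k, U k = tlen u \/ V k = 0) ->
  cumul (tcat u v) (fun k => U k + V k).
Proof.
move=> hU hV UV; have [U0 Um Un uE] := hU; have [V0 Vm Vn vE] := hV.
split => [|i j ij|k nk|t i] /=; first by rewrite U0 V0 addr0.
- by apply: lerD; [exact: Um|exact: Vm].
- by rewrite Un // Vn.
have := cumul_le i hU; have := cumul_le i.+1 hU.
have := cumul_ge0 i hV; have := cumul_ge0 i.+1 hV.
have := cumul_S i hV.
case: ltP => tu; rewrite ?uE ?vE;
  case: (UV i) => ?; case: (UV i.+1) => ?; lra.
Qed.

Lemma cumul_tpow c (t : R) : 0 <= t ->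
  cumul (tpow c t) (fun k => if (c < k)%N then t else 0).
Proof.
move=> t0; split => //= [i j ij|k nk|x i].
- case: ifP; case: ifP => //; lia.
- by rewrite (leq_trans (ltn_ord c)).
rewrite ltnS; split.
  by case: ifP => // xt [<-]; rewrite ltnn leqnn.
case: ltngtP => [_|_|/val_inj -> -> //] h; exfalso; lra.
Qed.

Lemma cumul_tsub u U (a b : R) : cumul u U -> 0 <= a -> a <= b -> b <= tlen u ->
  cumul (tsub u a b) (fun k => Num.min (Num.max (U k) a) b - a).
Proof.
move=> hU a0 ab bu; have [U0 Um Un uE] := hU; split => [|i j /Um ij|k nk|t i].
- by rewrite U0 (max_idPr a0) (min_idPl ab) subrr.
- by minmax_lra.
- by rewrite /= Un //; minmax_lra.
rewrite /=; case: ifP => tab; last first.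
  by split => // h; exfalso; move: h; minmax_lra.
by rewrite uE; minmax_lra.
Qed.

(** If U k < W (k+1), then at position U k the letter of [u] is at least k and that of [w] at most
    k. Conversely, where [w] has letter j, the position is below W (j+1) <= U j, so [u] has a letter
    below j. *)
Lemma row_lhdP u w U W : cumul u U -> cumul w W ->
  row_lhd u w <-> forall k, W k.+1 <= U k.
Proof.
move=> hU hW; have [_ _ Un uE] := hU; have [_ _ Wn wE] := hW.
split=> [[wu lhd] k|WU].
  rewrite leNgt; apply/negP => UW.
  have := cumul_le k.+1 hW; have := cumul_ge0 k hU => Uk0 Wl.
  have [|i [j [ui wj ij]]] := lhd (U k); first lra.
  have := cumul_lt k hU ui; rewrite ltxx => ik.
  by have := cumul_lt k.+1 hW wj; rewrite UW; lia.
(* The case k = n compares the lengths. *)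
split; first by rewrite -(Wn n.+1) // -(Un n) // ?leqnSn.
move=> t tw; have [j /andP[jt tj]] := cumul_find hW tw.
have [|i /andP[it ti]] := @cumul_find u U t hU.
  by have := WU j; have := cumul_le j hU; lra.
have ui : tval u t = Some i by apply/uE; lra.
exists i, j; split => //; first by apply/wE; lra.
by rewrite (cumul_lt _ hU ui); have := WU j; lra.
Qed.

End Cumulative.

(** * Row insertion as a last-passage recursion *)

Section RowInsertion.
Variables (R : realType) (n : nat).
Implicit Types (u v w : preword R n) (c i j : 'I_n) (U V : nat -> R) (k : nat).

Lemma eq_cumul u U V : cumul u U -> (forall k, U k = V k) -> cumul u V.
Proof. by move=> hU UV; have <- : U = V by exact/funext. Qed.

Lemma first_aboveE u U c : cumul u U -> U c.+1 < tlen u ->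
  first_above u c = U c.+1.
Proof.
move=> hU Uc; rewrite /first_above.
rewrite (_ : mkset _ = `[U c.+1, tlen u[%classic).
  by rewrite inf_itv.
apply/seteqP; split=> [t /= [j uj cj]|t /=].
  have := wfword_dom (cumul_wf hU) uj; have := cumul_lt c.+1 hU uj.
  rewrite in_itv /= ltnS leqNgt cj /= => /esym/negbT.
  by rewrite -leNgt => -> /andP[].
rewrite in_itv /= => ct; have := cumul_ge0 c.+1 hU => c0.
have [|j uj] := wfword_Some (t := t) (cumul_wf hU); first lra.
exists j => //; have := cumul_lt c.+1 hU uj; rewrite ltnS.
by case: leqP => // _ /esym; lra.
Qed.

(** The letters above c begin at U (c+1); the new run is written there and overwrites at most a
    length t of them. The min and the max cover all three cases of [rins1] at once. *)
Lemma rins1_cumul u U c (t : R) : cumul u U -> 0 <= t ->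
  cumul (rins1 u c t).1
    (fun k => if (k <= c)%N then 0 else Num.min (U k - U c.+1) t) /\
  cumul (rins1 u c t).2
    (fun k => if (k <= c)%N then U k else Num.max (U c.+1 + t) (U k)).
Proof.
move=> hU t0; have [U0 Um Un uE] := hU; rewrite /rins1.
have Uk k : if (k <= c)%N then U k <= U c.+1 else U c.+1 <= U k.
  by case: leqP => kc; apply: Um; lia.
have Ul k := cumul_le k hU; have Up k := cumul_ge0 k hU.
have Tc := cumul_tpow c t0.
case: asboolP => [uc|nuc].
  have Uc : U c.+1 = tlen u.
    apply/eqP; rewrite eq_le Ul /= leNgt; apply/negP => cu.
    have [|i ui] := wfword_Some (t := U c.+1) (cumul_wf hU).
      by rewrite Up.
    by have := cumul_lt c.+1 hU ui; rewrite ltxx ltnS (uc _ _ ui).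
  split => /=.
    apply: eq_cumul (cumul_tempty _ _) _ => k.
    by have := Uk k; have := Ul k; case: leqP => // _ ? ?; minmax_lra.
  apply: eq_cumul (cumul_tcat hU Tc _) _ => k.
    by have := Uk k; have := Ul k; case: leqP => // _ ? ?; [right|left; lra].
  by have := Uk k; have := Ul k; case: leqP => // _ ? ?; minmax_lra.
have Uc : U c.+1 < tlen u.
  rewrite lt_neqAle Ul andbT; apply/eqP => Uc; apply: nuc => x j uj.
  rewrite -ltnS (cumul_lt _ hU uj) Uc.
  by case/andP: (wfword_dom (cumul_wf hU) uj).
rewrite (first_aboveE hU Uc).
have hA := cumul_tsub hU (lexx 0) (Up c.+1) (Ul c.+1).
have hAT : cumul (tcat (tsub u 0 (U c.+1)) (tpow c t))
    (fun k => if (k <= c)%N then U k else U c.+1 + t).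
  apply: eq_cumul (cumul_tcat hA Tc _) _ => k /=;
    have := Uk k; have := Up k; case: leqP => _ ? ?; try by right.
  - by left; minmax_lra.
  - by minmax_lra.
  - by minmax_lra.
case: ifP => [tl|/negbT tl] /=; last first.
  have {}tl : tlen u - U c.+1 <= t by rewrite leNgt.
  split.
    apply: eq_cumul (cumul_tsub hU (Up c.+1) (Ul c.+1) (lexx _)) _ => k.
    by have := Uk k; have := Ul k; case: leqP => _ ? ?; minmax_lra.
  apply: eq_cumul hAT _ => k.
  by have := Uk k; have := Ul k; case: leqP => _ // ? ?; minmax_lra.
split.
  have a1 : U c.+1 <= U c.+1 + t by lra.
  have a2 : U c.+1 + t <= tlen u by lra.
  apply: eq_cumul (cumul_tsub hU (Up c.+1) a1 a2) _ => k.
  by have := Uk k; have := Ul k; case: leqP => _ ? ?; minmax_lra.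
have a1 : 0 <= U c.+1 + t by have := Up c.+1; lra.
have a2 : U c.+1 + t <= tlen u by lra.
apply: eq_cumul (cumul_tcat hAT (cumul_tsub hU a1 a2 (lexx _)) _) _ => k /=;
  have := Uk k; have := Ul k; case: leqP => _ ? ?.
- by right; minmax_lra.
- by left; lra.
- by minmax_lra.
- by minmax_lra.
Qed.

(* [bump U V] is the cumulative function of the row obtained by inserting the *)
(* row with cumulative function V into the one with cumulative function U.    *)
Fixpoint bump U V k : R :=
  if k is k'.+1 then Num.max (bump U V k') (U k) + (V k - V k') else 0.

Lemma bump_ge U V k : U 0%N = 0 -> (forall k, V k <= V k.+1) ->
  U k <= bump U V k.
Proof.
by move=> U0 VS; case: k => [|k] /=; [rewrite U0|have ? := VS k; minmax_lra].
Qed.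

(** When the inserted row has no letter above c, the recursion adds nothing beyond c+1 and only
    takes maxima with the increasing sequence U. *)
Lemma bump_const U V c k : U 0%N = 0 -> (forall k, V k <= V k.+1) ->
  {homo U : i j / (i <= j)%N >-> i <= j} ->
  (forall k, (c < k)%N -> V k = V c.+1) -> (c < k)%N ->
  bump U V k = Num.max (bump U V c.+1) (U k).
Proof.
move=> U0 VS Um Vc; elim: k => // k IH.
rewrite ltnS leq_eqVlt => /predU1P[<-|ck].
  by rewrite (max_idPl _) // bump_ge.
rewrite [LHS]/= IH // Vc 1?(Vc k) //; last lia.
by have ? := Um k k.+1 (leqnSn k); minmax_lra.
Qed.

(** Appending a run of c to a row with letters at most c changes [bump] exactly as [rins1] changes a
    row in [rins1_cumul]. *)
Lemma bump_add1 U V c (t : R) k : 0 <= t ->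
  (forall k, (c < k)%N -> V k = V c.+1) ->
  bump U (fun k => V k + (if (c < k)%N then t else 0)) k =
  if (k <= c)%N then bump U V k
  else Num.max (bump U V c.+1 + t) (bump U V k).
Proof.
move=> t0 Vc; elim: k => //= k ->; have [kc|ck|->] := ltngtP k c.
- have -> : (c < k.+1)%N = false by lia.
  by rewrite !addr0.
- have -> : (c < k.+1)%N by lia.
  rewrite (Vc k.+1) 1?(Vc k) ?leqW //.
  by set b := bump _ _ _; set b' := bump _ _ _; minmax_lra.
- by rewrite ltnSn; set b := bump _ _ _; minmax_lra.
Qed.

Lemma bumpS U V k :
  bump U V k.+1 = Num.max (bump U V k) (U k.+1) + (V k.+1 - V k).
Proof. by []. Qed.

Arguments bump : simpl never.

Lemma runs_word_rcons (cs : seq ('I_n * R)) c (t : R) :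
  all (fun ct => 0 < ct.2) cs -> 0 < t ->
  runs_word (rcons cs (c, t)) = tcat (runs_word cs) (tpow c t) /\
  wfword (runs_word cs).
Proof.
move=> cs0 t0.
have E cs' : runs_word cs' =
    foldr (@tcat R n) tempty [seq tpow ct.1 ct.2 | ct <- cs'].
  by elim: cs' => //= a l <-.
have wt : wfword (tpow c t) by apply: wfword_tpow; lra.
have wcs u : u \in [seq tpow ct.1 ct.2 | ct <- cs] -> wfword u.
  by case/mapP => ct ctcs ->; apply/wfword_tpow/ltW/(allP cs0).
rewrite !E map_rcons -cats1 foldr_tcat_cat /= ?tcatw0 //; last first.
  by move=> u; rewrite mem_cat mem_seq1 => /orP[/wcs|/eqP->].
by split => //; apply: wfword_foldr_tcat.
Qed.

Lemma cumul_tcat_tpow_inv u c (t : R) V : wfword u -> 0 < t ->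
  cumul (tcat u (tpow c t)) V ->
  exists U, [/\ cumul u U, forall k, (c < k)%N -> U k = U c.+1 &
    forall k, V k = U k + (if (c < k)%N then t else 0)].
Proof.
move=> wu t0 hV; have [V0 Vm Vn vE] := hV; have [u0 uD] := wu.
have Vl k : V k <= tlen u + t := cumul_le k hV.
have vc : tval (tcat u (tpow c t)) (tlen u) = Some c.
  by rewrite /= ltxx subrr lexx t0.
have /vE/andP[Vc _] := vc.
have Vc1 : V c.+1 = tlen u + t.
  apply/eqP; rewrite eq_le Vl /= leNgt; apply/negP => ct.
  (* If V (c+1) were short of the total length, this point would lie in the final run, carry the
     letter c, and yet not be below V (c+1). *)
  have /(cumul_lt c.+1 hV) :
      tval (tcat u (tpow c t)) (Num.max (tlen u) (V c.+1)) = Some c.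
    by rewrite /= ifF ?ifT //; minmax_lra.
  by rewrite ltnSn => /esym; minmax_lra.
have Vk k : if (c < k)%N then V k = tlen u + t else V k <= tlen u.
  case: ltnP => ck; last by apply: le_trans Vc; exact: Vm.
  by apply/eqP; rewrite eq_le Vl -Vc1 Vm.
exists (fun k => Num.min (V k) (tlen u)); split.
- split => [|i j ij|k nk|x i].
  + by rewrite V0 (min_idPl _).
  + by have := Vm _ _ ij; minmax_lra.
  + by rewrite Vn //= (min_idPr _) //; lra.
  + have := vE x i; rewrite /=; case: ltP => xu h.
      by rewrite h; minmax_lra.
    split; first by move/(wfword_dom wu) => ?; exfalso; lra.
    by move=> xV; exfalso; move: xV; minmax_lra.
- by move=> k ck; rewrite Vc1; have := Vk k; rewrite ck => ->.
- by move=> k; have := Vk k; case: ifP => _ ?; minmax_lra.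
Qed.

Lemma cumul_nil V : cumul (@tempty R n) V -> V = (fun=> 0).
Proof. by move=> hV; apply: cumul_unique hV (cumul_tempty _ _). Qed.

(** Induction on the last run. The result involves [cs] only through V, so the choice made by [runs]
    does not matter. *)
Lemma rins_runs_cumul u U cs V : cumul u U ->
  all (fun ct => 0 < ct.2) cs -> cumul (runs_word cs) V ->
  cumul (rins_runs u cs).1 (fun k => U k + V k - bump U V k) /\
  cumul (rins_runs u cs).2 (bump U V).
Proof.
move=> hU; have [U0 Um Un _] := hU.
elim/last_ind: cs V => [|cs [c t] IH] V.
  move=> _ /cumul_nil ->; rewrite /rins_runs /=.
  have E k : bump U (fun=> 0) k = U k.
    elim: k => [|k IHk]; first by rewrite U0.
    by rewrite bumpS IHk; have ? := cumul_S k hU; minmax_lra.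
  split; last exact: (eq_cumul hU).
  by apply: eq_cumul (cumul_tempty _ _) _ => k; rewrite E; lra.
rewrite all_rcons /= => /andP[t0 cs0].
have [-> wcs] := runs_word_rcons c cs0 t0.
move=> /(cumul_tcat_tpow_inv wcs t0)[W [hW Wc VE]].
have {VE V} -> : V = fun k => W k + (if (c < k)%N then t else 0).
  exact/funext.
have [h1 h2] := IH _ cs0 hW.
have WS k := cumul_S k hW.
rewrite /rins_runs foldl_rcons /=; move: h1 h2; rewrite /rins_runs.
set p := foldl _ _ _ => h1 h2.
have [q1 q2] := rins1_cumul c h2 (ltW t0).
have bE := bump_add1 U _ (ltW t0) Wc.
split; last by apply: eq_cumul q2 _ => k; rewrite bE.
apply: eq_cumul (cumul_tcat h1 q1 _) _ => k /=; last first.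
  rewrite bE; case: leqP => ck; first lra.
  by set b := bump _ _ _; set b' := bump _ _ _; minmax_lra.
case: leqP => ck; [by right|].
(* The ejected pieces must concatenate to a row. For k > c, either the current row has no letter
   strictly between c and k, and the new run ejects nothing below k; or it has one, and then
   everything ejected earlier is below k. *)
have [_ _ hl _] := h1; rewrite -(hl (maxn n k)) ?leq_maxl //.
have cm : (c < maxn n k)%N by rewrite leq_max ck orbT.
have Ukm : U k <= U (maxn n k) by apply: Um; rewrite leq_maxr.
rewrite (bump_const U0 WS Um Wc ck) (bump_const U0 WS Um Wc cm).
rewrite (Wc _ ck) (Wc _ cm).
have [le|lt] := leP (U k) (bump U W c.+1).
  by right; rewrite subrr (min_idPl (ltW t0)).
by left; rewrite (max_idPr (ltW (lt_le_trans lt Ukm))); lra.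
Qed.

Lemma runs_exist v : is_timed_row v -> exists cs, runs_decomposition v cs.
Proof.
move=> /row_cumul hV; move: (cumfn v) hV => V hV; have [V0 Vm Vn vE] := hV.
have pos k : 0 <= V k.+1 - V k by have := cumul_S k hV; lra.
(* The runs are built letter by letter; at stage k they spell the prefix of letters below k. Letters
   of measure zero are skipped, since runs must have positive length. *)
suff: forall k, (k <= n)%N -> exists cs : seq ('I_n * R),
    all (fun ct => 0 < ct.2) cs /\
    cumul (runs_word cs) (fun m => V (minn m k)).
  move=> /(_ n (leqnn n))[cs [cs0 hcs]]; exists cs; split => //.
  apply: (cumul_inj hV); apply: eq_cumul hcs _ => j.
  by case: (leqP n j) => // nj; rewrite !Vn.
elim=> [_|k IH kn].
  exists [::]; split => //; apply: eq_cumul (cumul_tempty _ _) _ => j.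
  by rewrite minn0 V0.
have [cs [cs0 hcs]] := IH (ltnW kn).
have [VV|VV] := eqVneq (V k.+1) (V k).
  exists cs; split => //; apply: eq_cumul hcs _ => j.
  have [jk|jk] := leqP j k; first by rewrite !(minn_idPl _) // leqW.
  by rewrite (minn_idPr jk) VV.
have t0 : 0 < V k.+1 - V k by rewrite lt_neqAle pos andbT eq_sym subr_eq0 VV.
exists (rcons cs (Ordinal kn, V k.+1 - V k)).
rewrite all_rcons /= t0; split => //.
have [-> wcs] := runs_word_rcons (Ordinal kn) cs0 t0.
apply: eq_cumul (cumul_tcat hcs (cumul_tpow _ (ltW t0)) _) _ => j /=.
  case: ltnP => jk; [left|by right]; have [_ _ hn _] := hcs.
  by rewrite -(hn n) // ?(minn_idPr (ltnW jk)) (minn_idPr (ltnW kn)).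
case: ltnP => jk; last by rewrite !(minn_idPl _) ?addr0 // leqW.
by rewrite (minn_idPr jk) ?(minn_idPr (ltnW jk)); lra.
Qed.

Lemma rins_cumul u U v V : cumul u U -> cumul v V ->
  cumul (rins u v).1 (fun k => U k + V k - bump U V k) /\
  cumul (rins u v).2 (bump U V).
Proof.
move=> hU hV; have [vE cs0] := xgetPex [::] (runs_exist (cumul_row hV)).
by apply: rins_runs_cumul => //; rewrite /runs -vE.
Qed.

End RowInsertion.

(** * Uniqueness of row decompositions, and weight and shape read from the rows *)

Section RowDecompositions.
Variables (R : realType) (n : nat).
Implicit Types (u v w : preword R n) (us : seq (preword R n)).
Implicit Types (c i j : 'I_n) (k : nat).
Local Open Scope classical_set_scope.

Definition nonempty_rows us :=
  forall u, u \in us -> is_timed_row u /\ 0 < tlen u.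

Lemma nonempty_rows_cons u us : nonempty_rows (u :: us) ->
  [/\ is_timed_row u, 0 < tlen u & nonempty_rows us].
Proof.
move=> usP; have [ru u0] := usP u (mem_head _ _).
by split => // v vus; apply: usP; rewrite inE vus orbT.
Qed.

Lemma nth_cumul us m : nonempty_rows us ->
  cumul (nth tempty us m) (cumfn (nth tempty us m)).
Proof.
move=> usP; apply: row_cumul; have [mus|mus] := ltnP m (size us).
  by case: (usP (nth tempty us m) (mem_nth _ mus)).
by rewrite nth_default //; exact: cumul_row (cumul_tempty _ _).
Qed.

Lemma row_wf u : is_timed_row u -> wfword u.
Proof. by case=> /timed_word_wf. Qed.

Lemma nonempty_rows_wf us : nonempty_rows us -> forall u, u \in us -> wfword u.
Proof. by move=> usP u /usP[/row_wf]. Qed.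

Lemma rows_word_wf us : nonempty_rows us -> wfword (rows_word us).
Proof.
move=> /nonempty_rows_wf usP; apply: wfword_foldr_tcat => u.
by rewrite mem_rev => /usP.
Qed.

Lemma timed_word_rows us : nonempty_rows us -> is_timed_word (rows_word us).
Proof.
elim: us => [|u us IH] usP; first exact: timed_word_tempty.
rewrite rows_word_cons; last exact: nonempty_rows_wf.
have [[hu _] _ {}/IH h] := nonempty_rows_cons usP.
exact: timed_word_tcat.
Qed.

(* If the concatenation is not a row, some threshold k separates the last     *)
(* letter of [u] from the first letter of [v].                                *)
Lemma not_row_tcat u v : is_timed_row u -> is_timed_row v ->
  ~ is_timed_row (tcat u v) ->
  exists k, cumfn u k < tlen u /\ 0 < cumfn v k.
Proof.
move=> /row_cumul hu /row_cumul hv; apply: contra_notP => h.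
apply: cumul_row (cumul_tcat hu hv _) => k.
have uk := cumul_le k hu; have vk := cumul_ge0 k hv.
have [u1|u1] := leP (tlen u) (cumfn u k); first by left; lra.
have [v1|v1] := ltP 0 (cumfn v k); last by right; lra.
by case: h; exists k.
Qed.

Lemma tcat_inj u v u' v' : wfword u -> wfword v -> wfword u' -> wfword v' ->
  tlen u = tlen u' -> tcat u v = tcat u' v' -> u = u' /\ v = v'.
Proof.
move=> wu wv wu' wv' luu' [lE fE].
have f t : (if t < tlen u then tval u t else tval v (t - tlen u)) =
    (if t < tlen u' then tval u' t else tval v' (t - tlen u')).
  exact: (congr1 (@^~ t) fE).
split; apply: preword_ext => //.
- move=> t i; have := f t; rewrite -luu'; case: ltP => [_ -> //|ut _].
  by rewrite !wfword_None //; apply/negP; lra.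
- by lra.
- move=> t i; have := f (t + tlen u).
  rewrite -luu' addrK; case: ltP => [t0 _|_ -> //].
  by rewrite !wfword_None //; apply/negP; lra.
Qed.

Definition descending us := forall k, (k.+1 < size us)%N ->
  ~ is_timed_row (tcat (nth tempty us k.+1) (nth tempty us k)).

Lemma descending_cons u us : descending (u :: us) -> descending us.
Proof. by move=> h k ks; apply: (h k.+1). Qed.

(** A longer row suffix [u'] would reach into the factor [a] before [u]. It would contain a letter
    of [a] that is at least k followed by the first letter of [u], which is below k, for the
    threshold k of [not_row_tcat]. *)
Lemma last_row_maximal u us u' us' :
  nonempty_rows (u :: us) -> descending (u :: us) ->
  nonempty_rows (u' :: us') ->
  rows_word (u :: us) = rows_word (u' :: us') -> tlen u' <= tlen u.
Proof.
move=> usP usd usP' E; rewrite leNgt; apply/negP => uu'.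
move: E; rewrite !rows_word_cons; try exact: nonempty_rows_wf.
have [ru u0 {}usP] := nonempty_rows_cons usP.
have [[_ mono'] u'0 {}/rows_word_wf[X'0 _]] := nonempty_rows_cons usP'.
set X' := rows_word us' in X'0 *.
case: us usP usd => [|a us] usP usd.
  by move=> [lE _]; move: lE => /=; lra.
rewrite rows_word_cons; last exact: nonempty_rows_wf.
have [ra a0 {}/rows_word_wf[Y0 _]] := nonempty_rows_cons usP.
set Y := rows_word us in Y0 *.
move=> [lE fE].
have [k [ak uk]] := not_row_tcat ra ru (usd 0%N isT).
have ha := row_cumul ra; have hu := row_cumul ru.
(* A position in [a], counted from its start, that carries a letter at least k and also lies inside
   [u']. *)
pose s := Num.max (cumfn a k) (tlen X' - tlen Y).
have ak0 := cumul_ge0 k ha.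
have sa : s < tlen a by rewrite /s; move: lE => /= ?; minmax_lra.
have as' : cumfn a k <= s by rewrite /s; minmax_lra.
have Xs : tlen X' - tlen Y <= s by rewrite /s; minmax_lra.
have [|i ai] := wfword_Some (t := s) (row_wf ra); first lra.
have [|j uj] := wfword_Some (t := 0) (row_wf ru); first lra.
have ki : (k <= i)%N.
  by rewrite leqNgt (cumul_lt _ ha ai) -leNgt.
have jk : (j < k)%N by rewrite (cumul_lt _ hu uj).
move: lE => /= lE.
have := mono' (tlen Y + s - tlen X') (tlen Y + tlen a - tlen X') i j.
suff [-> ->] : tval u' (tlen Y + s - tlen X') = Some i /\
    tval u' (tlen Y + tlen a - tlen X') = Some j.
  move=> /(_ _ erefl erefl) ij; move: (leq_trans jk ki).
  by rewrite ltnNge ij //; lra.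
split.
  have := congr1 (@^~ (tlen Y + s)) fE => /=.
  rewrite (_ : _ < tlen X' = false); last by apply/negbTE; rewrite -leNgt; lra.
  rewrite (_ : _ < tlen Y + tlen a); last lra.
  rewrite (_ : _ < tlen Y = false); last by apply/negbTE; rewrite -leNgt; lra.
  by rewrite addrAC subrr add0r ai => ->.
have := congr1 (@^~ (tlen Y + tlen a)) fE => /=.
by rewrite ltxx subrr uj ifF //; apply/negbTE; rewrite -leNgt; lra.
Qed.

Lemma row_decomposition_unique us us' :
  nonempty_rows us -> descending us -> nonempty_rows us' -> descending us' ->
  rows_word us = rows_word us' -> us = us'.
Proof.
have nil u vs : nonempty_rows (u :: vs) -> rows_word (u :: vs) <> tempty.
  move=> usP; rewrite rows_word_cons; last exact: nonempty_rows_wf.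
  have [_ u0 /rows_word_wf[X0 _]] := nonempty_rows_cons usP.
  by move=> [lE _]; lra.
elim: us us' => [|u us IH] [|u' us'] // usP usd usP' usd'.
- by move/esym/nil.
- by move/nil.
move=> E; have uu' : tlen u = tlen u'.
  apply/eqP; rewrite eq_le (last_row_maximal usP' usd' usP) //.
  by rewrite (last_row_maximal usP usd usP').
move: E; rewrite !rows_word_cons; try exact: nonempty_rows_wf.
have [/row_wf wu _ tP] := nonempty_rows_cons usP.
have [/row_wf wu' _ tP'] := nonempty_rows_cons usP'.
move=> E; have [|||X ->] := tcat_inj _ wu _ wu' _ E.
- exact: rows_word_wf.
- exact: rows_word_wf.
- by move: E => [lE _]; lra.
rewrite (IH us') //; first exact: descending_cons usd.
exact: descending_cons usd'.
Qed.

Lemma row_dec_rows us : row_decomposition (rows_word us) us ->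
  row_dec (rows_word us) = us.
Proof.
move=> [_ usP usd]; apply: xget_unique => // us' [E usP' usd'].
exact/esym/row_decomposition_unique.
Qed.

(** The tableau condition through [row_lhdP]. Beyond the list the default [tempty] has cumulative
    function 0, so m needs no bound. *)
Definition lhd_chain us := forall m k,
  cumfn (nth tempty us m.+1) k.+1 <= cumfn (nth tempty us m) k.

Lemma lhd_chainP us : nonempty_rows us ->
  lhd_chain us <-> forall k, (k.+1 < size us)%N ->
    row_lhd (nth tempty us k) (nth tempty us k.+1).
Proof.
move=> usP; split=> [usc m _|usl m k].
  by apply/(row_lhdP (nth_cumul _ usP) (nth_cumul _ usP)).
have [ms|ms] := ltnP m.+1 (size us); last first.
  rewrite [nth _ us m.+1]nth_default // (cumfn_cumul (cumul_tempty _ _)).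
  exact: cumul_ge0 (nth_cumul _ usP).
by move: k; apply/(row_lhdP (nth_cumul _ usP) (nth_cumul _ usP)); exact: usl.
Qed.

Lemma lhd_chain_decomposition us : nonempty_rows us -> lhd_chain us ->
  row_decomposition (rows_word us) us.
Proof.
move=> usP usc; split => // k ks [_ mono].
have /lhd_chainP := usc; move=> /(_ usP k ks) [_].
have [_ u0] := usP _ (mem_nth tempty ks).
(* The product has a descent from its first letter j to the first letter i of its second factor. *)
move=> /(_ 0); rewrite lexx u0 => /(_ isT)[i [j [ui uj ij]]].
suff : (j <= i)%N by lia.
by apply: (mono 0 (tlen (nth tempty us k.+1))) => /=;
  [exact: ltW|rewrite u0|rewrite ltxx subrr].
Qed.

Lemma lhd_chain_partition us : nonempty_rows us -> lhd_chain us ->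
  real_partition [seq tlen u | u <- us].
Proof.
move=> usP usc; split; last first.
  by apply/allP => x /mapP[u /usP[_ u0] ->]; exact: ltW.
apply/(sortedP 0) => m; rewrite size_map => ms.
rewrite !(nth_map tempty) //; last exact: ltnW.
have [_ _ hn _] := nth_cumul m usP; have [_ _ hn' _] := nth_cumul m.+1 usP.
by rewrite /= -(hn n) // -(hn' n.+1).
Qed.

(** The shift [a] makes the induction go through: the tail of a concatenation is the same kind of
    word with a larger shift. The head contributes one interval, disjoint from the rest. *)
Lemma level_rows (rs : seq (preword R n)) i (a : R) :
  (forall u, u \in rs -> is_timed_row u) ->
  let S := [set t | tval (foldr (@tcat R n) tempty rs) (t - a) = Some i] in
  measurable S /\ lebesgue_measure S =
    (\sum_(u <- rs) (cumfn u i.+1 - cumfn u i))%:E.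
Proof.
elim: rs a => [|u rs IH] a rsP S.
  rewrite /S (_ : mkset _ = set0); last by apply/seteqP; split.
  by rewrite big_nil; split; [exact: measurable0|exact: measure0].
have hu : cumul u (cumfn u) by apply/row_cumul/rsP/mem_head.
have rsP' v : v \in rs -> is_timed_row v.
  by move=> vrs; apply: rsP; rewrite inE vrs orbT.
have wrs : wfword (foldr (@tcat R n) tempty rs).
  by apply: wfword_foldr_tcat => v /rsP' /row_wf.
have [mS' S'E] := IH (a + tlen u) rsP'.
set S' := mkset _ in mS' S'E.
have -> : S = `[a + cumfn u i, a + cumfn u i.+1[ `|` S'.
  clear IH mS' S'E; have [_ _ _ uE] := hu; have le := cumul_le i.+1 hu.
  apply/seteqP; split=> t; rewrite /S /S' /= in_itv /= opprD addrA;
    case: (ltP (t - a) (tlen u)) => ut.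
  - by move/uE => ?; left; lra.
  - by right.
  - move=> [tI|/(wfword_dom wrs) tI]; last by exfalso; lra.
    by apply/uE; lra.
  - by move=> [|//] ?; exfalso; lra.
have mI : measurable `[a + cumfn u i, a + cumfn u i.+1[.
  exact: measurable_itv.
split; first exact: measurableU.
have IE : lebesgue_measure `[a + cumfn u i, a + cumfn u i.+1[%classic =
    (cumfn u i.+1 - cumfn u i)%:E.
  rewrite lebesgue_measure_itv /= lte_fin -EFinB.
  have le := cumul_S i hu; case: ltP => h; congr EFin; clear S'E; lra.
move: mI IE; set I := [set` _] => mI IE.
transitivity (lebesgue_measure I + lebesgue_measure S')%E; last first.
  by rewrite IE S'E big_cons EFinD.
apply: measureU => //; apply/seteqP; split => // t [/=].
rewrite /I /= in_itv /= => tI.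
clear S'E; move/(wfword_dom wrs).
by have := cumul_le i.+1 hu; lra.
Qed.

Lemma weight_rows us i : (forall u, u \in us -> is_timed_row u) ->
  twt (rows_word us) 0 i = \sum_(u <- us) (cumfn u i.+1 - cumfn u i).
Proof.
move=> usP; rewrite mxE -(perm_big _ (permEl (perm_rev us))) /=.
have [|_] := @level_rows (rev us) i 0.
  by move=> u; rewrite mem_rev => /usP.
rewrite /rows_word; under eq_set => t do rewrite subr0.
by move=> ->.
Qed.

End RowDecompositions.

(** * Tableau insertion *)

Section Insertion.
Variables (R : realType) (n : nat).
Implicit Types (u v w : preword R n) (us : seq (preword R n)).
Implicit Types (U V W : nat -> R) (k : nat).

Arguments bump : simpl never.

Lemma bump0 V : V 0%N = 0 -> (forall k, V k <= V k.+1) ->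
  bump (fun=> 0) V = V.
Proof.
move=> V0 VS; apply/funext; elim=> [|k IH]; first by rewrite V0.
have Vk0 : 0 <= V k by elim: (k) => [|m Vm]; [rewrite V0|exact: le_trans Vm _].
by rewrite bumpS IH; minmax_lra.
Qed.

(** The first bound gives interleaving and drives the induction; the second is the tableau condition
    between the two new rows. *)
Lemma bump_ejected U V W k :
  U 0%N = 0 -> V 0%N = 0 -> (forall k, U k <= U k.+1) ->
  (forall k, V k <= V k.+1) -> (forall k, W k.+1 <= U k) ->
  let D k := U k + V k - bump U V k in
  bump W D k <= U k /\ bump W D k.+1 <= bump U V k.
Proof.
move=> U0 V0 US VS WU D.
have step m : bump W D m <= U m ->
    bump W D m.+1 <= Num.min (bump U V m) (U m.+1).
  (* Writing B and B' for the two bumps, B' (m+1) = max (B' m) (W (m+1)) + min (B m) (U (m+1)) - U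
     m, and both arguments of the max are at most U m. *)
  by move=> h; have := WU m; rewrite bumpS /D bumpS; minmax_lra.
have le m : bump W D m <= U m.
  elim: m => [|m /step]; first by rewrite U0.
  by rewrite le_min => /andP[].
by split => //; have := step k (le k); rewrite le_min => /andP[].
Qed.

(** The cumulative function of the first new row is part of the invariant because the row inserted
    one level earlier is compared with it through [bump_ejected]. *)
Lemma insert_rows_spec us v : nonempty_rows us -> lhd_chain us ->
  is_timed_row v -> exists us',
  [/\ insert_rows us v = rows_word us', nonempty_rows us', lhd_chain us',
      forall m k, cumfn (nth tempty us' m.+1) k <= cumfn (nth tempty us m) k
        <= cumfn (nth tempty us' m) k
    & cumfn (nth tempty us' 0) =
        bump (cumfn (nth tempty us 0)) (cumfn v) /\
      forall k, \sum_(u <- us') cumfn u k =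
        \sum_(u <- us) cumfn u k + cumfn v k].
Proof.
have c0 : cumfn (@tempty R n) = fun=> 0 := cumfn_cumul (cumul_tempty _ _).
elim: us v => [|u us IH] v usP usc rv; have hv := row_cumul rv;
  have [V0 _ Vn _] := hv; have VS k := cumul_S k hv.
  have bV : bump (fun=> 0) (cumfn v) = cumfn v by exact: bump0.
  (* What is ejected from the last row becomes a new row only if it is nonempty. *)
  have [v0|v0] := ltP 0 (tlen v).
    exists [:: v]; split => [|u|m k|m k|].
    - by rewrite /rows_word /= tcatw0 //; exact: row_wf.
    - by rewrite inE => /eqP ->.
    - by case: m => [|m] /=; rewrite ?nth_nil c0 //; exact: cumul_ge0 hv.
    - by case: m => [|m] /=; rewrite ?nth_nil c0 lexx ?(cumul_ge0 k hv).
    - by rewrite /= c0 bV; split => // k; rewrite big_seq1 big_nil add0r.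
  have vE : v = tempty.
    apply: (cumul_inj hv); apply: eq_cumul (cumul_tempty _ _) _ => k.
    by have := cumul_le k hv; have := cumul_ge0 k hv; lra.
  exists [::]; rewrite vE; split => //.
  - by move=> m k; rewrite !nth_nil c0 lexx.
  - by rewrite /= c0 bump0 //; split => // k; rewrite !big_nil addr0.
have [ru u0 usP'] := nonempty_rows_cons usP.
have hu := row_cumul ru; have [U0 _ Un _] := hu.
have US k := cumul_S k hu.
have [hD hB] := rins_cumul hu hv.
have usc' : lhd_chain us by move=> m k; exact: (usc m.+1 k).
have WU k : cumfn (nth tempty us 0) k.+1 <= cumfn u k by exact: (usc 0%N k).
have [us' [E us'P us'c us'i [us'0 us's]]] :=
  IH _ usP' usc' (cumul_row hD).
have ej k := bump_ejected k U0 V0 US VS WU.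
exists ((rins u v).2 :: us'); split.
- rewrite /= E rows_word_cons // => w; rewrite inE => /predU1P[->|].
    exact: cumul_wf hB.
  exact: nonempty_rows_wf.
- move=> w; rewrite inE => /predU1P[->|/us'P //].
  split; first exact: cumul_row hB.
  have [_ _ Bn _] := hB; rewrite -(Bn n) //.
  by apply: lt_le_trans (bump_ge _ U0 VS); rewrite Un.
- move=> [|m] k /=; last exact: us'c.
  by rewrite us'0 (cumfn_cumul hD) (cumfn_cumul hB); case: (ej k).
- move=> [|m] k /=; last exact: us'i.
  rewrite us'0 (cumfn_cumul hD) (cumfn_cumul hB) bump_ge // andbT.
  by case: (ej k).
- rewrite /= (cumfn_cumul hB); split => // k.
  by rewrite !big_cons us's (cumfn_cumul hD) (cumfn_cumul hB); lra.
Qed.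

End Insertion.

Unset Implicit Arguments.

Theorem theorem2p15 (R : realType) (n : nat) (w v : preword R n)
  (hw : is_timed_tableau w) (hv : is_timed_row v) :
  [/\ is_timed_tableau (tinsert w v),
      twt (tinsert w v) = twt w + twt v
    & interleaves (tshape w) (tshape (tinsert w v))].
Proof.
have [_ [us [wE usP usd] usl]] := hw; rewrite {w hw}wE.
have usc : lhd_chain us by apply/lhd_chainP.
rewrite /tinsert /tshape row_dec_rows //.
have [us' [-> us'P us'c us'i [_ us's]]] := insert_rows_spec usP usc hv.
have us'd := lhd_chain_decomposition us'P us'c.
rewrite row_dec_rows //; split.
- split; first exact: timed_word_rows.
  by exists us' => //; apply/lhd_chainP.
- apply/rowP => i; rewrite [RHS]mxE.
  have -> : v = rows_word [:: v].
    by rewrite /rows_word /= tcatw0 //; exact: row_wf.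
  rewrite !weight_rows ?big_seq1; first 1 last.
  + by move=> u; rewrite inE => /eqP ->.
  + by move=> u /usP[].
  + by move=> u /us'P[].
  (* Each weight entry is the increment from i to i+1 of the summed cumulative functions. *)
  by rewrite !sumrB !us's; lra.
split; [exact: lhd_chain_partition|exact: lhd_chain_partition|move=> m].
(* Row lengths are values at n, and padding a shape by 0 agrees with padding the rows by [tempty];
   interleaving is then the invariant at k = n. *)
have tE (us0 : seq (preword R n)) l : nonempty_rows us0 ->
    [seq tlen u | u <- us0]`_l = cumfn (nth tempty us0 l) n.
  move=> us0P; have [_ _ -> //] := nth_cumul l us0P.
  have [ls|ls] := ltnP l (size us0); first by rewrite (nth_map tempty).
  by rewrite !nth_default // size_map.
by rewrite !tE.
Qed.
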